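(* Let $(\Omega,\mathcal{F},\mathbb{P})$ be a probability space and $X:\Omega\to\mathbb{R}$ a real random variable. Then there exists a right-continuous nondecreasing function $\alpha:\mathbb{R}\to\mathbb{R}$ such that $$\mathbb{E}(f(X))=\int_{\mathbb{R}}f(t)\,d\lambda_\alpha(t)\qquad\text{for all }f\in\mathcal{C}_c(\mathbb{R}).$$ Moreover, for every such $\alpha$: (i) $\lambda_\alpha$ is a probability measure and $\lambda_\alpha(B)=\mathbb{P}(X^{-1}(B))$ for every Borel set $B\subset\mathbb{R}$; (ii) the limit $c_-:=\lim_{x\to-\infty}\alpha(x)$ exists in $\mathbb{R}$, and the function $F:\mathbb{R}\to\mathbb{R}$, $F(x):=\alpha(x)-c_-$, is right-continuous and nondecreasing and satisfies $F(x)=\mathbb{P}(X^{-1}((-\infty,x]))$ for all $x\in\mathbb{R}$, $\lim_{x\to-\infty}F(x)=0$, and $\lim_{x\to+\infty}F(x)=1$; (iii) $\mathbb{E}(f(X))=\int_{\mathbb{R}}f\,d\lambda_F$ for all $f\in\mathcal{C}_c(\mathbb{R})$.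
   Context: $\mathcal{C}_c(\mathbb{R})$ is the space of real continuous functions on $\mathbb{R}$ with compact support. $\mathbb{E}(f(X))=\int_\Omega f(X(\omega))\,d\mathbb{P}(\omega)$. For a right-continuous nondecreasing function $\alpha:\mathbb{R}\to\mathbb{R}$, $\lambda_\alpha$ denotes the Lebesgue--Stieltjes measure generated by $\alpha$, i.e. the unique Borel measure on $\mathbb{R}$ with $\lambda_\alpha((a,b])=\alpha(b)-\alpha(a)$ for all $a<b$. *)

(* Defs.v *)
From HB Require Import structures.
From mathcomp Require Import all_boot all_order all_algebra.
From mathcomp Require Import all_classical all_reals all_analysis.

Set Implicit Arguments.
Unset Strict Implicit.
Unset Printing Implicit Defensive.

Import Order.TTheory GRing.Theory Num.Theory.
Import numFieldNormedType.Exports.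

Local Open Scope classical_set_scope.
Local Open Scope ring_scope.

(* The support is the closure of the set where [f] does not vanish; the library
   predicate [support f] is only the latter set. *)
Definition Cc (R : realType) : set (R -> R) :=
  [set f | continuous f /\ compact (closure [set x | f x != 0])].

(* [cumulative R R] is the library's type of right-continuous nondecreasing
   functions from [R] to [R], so a variable [alpha : cumulative R R] ranges over
   exactly the functions that generate a Lebesgue-Stieltjes measure.  Both
   sides are extended reals; they are finite for [f] in [Cc R]. *)
Definition represents (d : measure_display) (Omega : measurableType d)
    (R : realType) (P : probability Omega R) (X : {RV P >-> R})
    (alpha : cumulative R R) : Prop :=
  forall f : R -> R, Cc f ->
    ('E_P[f \o X] = \int[lebesgue_stieltjes_measure alpha]_t (f t)%:E)%E.

(* Main.v *)
Require Import Defs.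
From HB Require Import structures.
From mathcomp Require Import all_boot all_order all_algebra.
From mathcomp Require Import all_classical all_reals all_analysis.
From mathcomp Require Import measurable_realfun lra.

Set Implicit Arguments.
Unset Strict Implicit.
Unset Printing Implicit Defensive.

Import Order.TTheory GRing.Theory Num.Theory.
Import numFieldNormedType.Exports.

Local Open Scope classical_set_scope.
Local Open Scope ring_scope.

(** The trapezoids [bump a b n] are compactly supported, continuous, bounded by
    the indicator of [[a, b + 1]] and converge pointwise to that of []a, b]], so
    by dominated convergence [alpha] represents [X] iff its Lebesgue-Stieltjes
    measure and the law of [X] agree on all intervals []a, b]].  Hence they agree
    on Borel sets, and [alpha] is the distribution function of [X] up to an
    additive constant; all the limits are then those of the latter. *)

(** * Trapezoids approximating a half-open interval *)

Definition ramp (R : realType) (n : nat) (u : R) : R :=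
  Num.min 1 (Num.max 0 (n%:R * u)).

(** Modelled on 1_{t > a} (1 - 1_{t > b}), with [ramp n] in place of the indicator of the open
    positive half-line. The product makes continuity immediate and also covers [b < a]. *)
Definition bump (R : realType) (a b : R) (n : nat) (t : R) : R :=
  ramp n (t - a) * (1 - ramp n (t - b)).

Section Bump.
Context {R : realType}.
Implicit Types (a b t u : R) (n : nat).

Lemma ramp_itv n u : 0 <= ramp n u <= 1.
Proof. by rewrite /ramp le_min ler01 le_max lexx ge_min lexx. Qed.

Lemma ramp_le0 n u : u <= 0 -> ramp n u = 0.
Proof.
move=> u0; rewrite /ramp (max_idPl _) ?min_r ?ler01//.
by rewrite mulr_ge0_le0.
Qed.

Lemma ramp_ge1 n u : 1 <= n%:R * u -> ramp n u = 1.
Proof. by move=> nu; rewrite /ramp min_l// le_max nu orbT. Qed.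

Lemma ramp_eventually1 u : 0 < u -> \forall n \near \oo, ramp n u = 1.
Proof.
move=> u0; near=> n; apply: ramp_ge1.
by rewrite -ler_pdivrMr//; near: n; exact: nbhs_infty_ger.
Unshelve. all: by end_near. Qed.

Lemma continuous_ramp n : continuous (@ramp R n).
Proof.
move=> u; apply: (@continuous_min _ _ (cst 1) (fun u : R => Num.max 0 (n%:R * u))).
  exact: cst_continuous.
apply: (@continuous_max _ _ (cst 0) (fun u : R => n%:R * u)).
  exact: cst_continuous.
exact: mulrl_continuous.
Qed.

Lemma continuous_bump a b n : continuous (bump a b n).
Proof.
have shift c : continuous (fun t : R => ramp n (t - c)).
  move=> t; apply: (@continuous_comp _ _ _ (fun t => t - c) (ramp n)).
    by apply: cvgB; [exact: cvg_id|exact: cvg_cst].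
  exact: continuous_ramp.
move=> t; apply: cvgM; first exact: shift.
by apply: cvgB; [exact: cvg_cst|exact: shift].
Qed.

Lemma bump_itv a b n t : 0 <= bump a b n t <= 1.
Proof.
have /andP[p0 p1] := ramp_itv n (t - a); have /andP[q0 q1] := ramp_itv n (t - b).
by rewrite mulr_ge0 ?subr_ge0//= mulr_ile1 ?subr_ge0// gerBl.
Qed.

(** From index 1 on the slope is at least 1, so the second ramp has reached 1 by [b + 1]. Hence the
    shift [n.+1]: one segment then contains all the supports. *)
Lemma bump_out a b n t : ~~ (a <= t <= b + 1) -> bump a b n.+1 t = 0.
Proof.
rewrite negb_and -!ltNge => /orP[ta|bt]; rewrite /bump.
  by rewrite ramp_le0 ?mul0r// subr_le0 ltW.
rewrite [X in _ * (1 - X)]ramp_ge1 ?subrr ?mulr0//.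
rewrite (le_trans (_ : 1 <= t - b))//; first by lra.
by rewrite ler_peMl ?ler1n//; lra.
Qed.

Lemma bump_le_indic a b n t : bump a b n.+1 t <= \1_`[a, b + 1] t.
Proof.
rewrite indicE mem_setE in_itv/=.
have [_|/bump_out->//] := boolP (a <= t <= b + 1).
by have /andP[] := bump_itv a b n.+1 t.
Qed.

Lemma bump_Cc a b n : Cc (bump a b n.+1).
Proof.
split; first exact: continuous_bump.
apply: (@subclosed_compact _ _ `[a, b + 1]%classic).
- exact: closed_closure.
- exact: segment_compact.
- have /closure_id -> : closed `[a, b + 1]%classic by exact: interval_closed.
  apply: closureS.
  move=> t /= /eqP ft; rewrite in_itv/=; apply: contrapT => /negP tab.
  by apply: ft; exact: bump_out.
Qed.

(** At each point the sequence is eventually constant. Since [ramp n] vanishes at 0 for every [n],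
    the limit is 0 at [a] and, when [a < b], 1 at [b]: exactly the half-open interval. *)
Lemma bump_cvg a b t : bump a b n t @[n --> \oo] --> (\1_`]a, b] t : R).
Proof.
apply: cvg_near_cst.
rewrite indicE mem_setE in_itv/=; have [ta|at_] := leP t a.
  by apply: nearW => n; rewrite /bump ramp_le0 ?mul0r// subr_le0.
have ra := ramp_eventually1 (_ : 0 < t - a).
have [tb|bt] := leP t b.
  near=> n; rewrite /bump (ramp_le0 _ (_ : t - b <= 0)) ?subr_le0// subr0 mulr1.
  by near: n; apply: ra; rewrite subr_gt0.
near=> n; rewrite /bump (_ : ramp n (t - b) = 1) ?subrr ?mulr0//.
by near: n; apply: ramp_eventually1; rewrite subr_gt0.
Unshelve. all: by end_near. Qed.

End Bump.

(** * Interval masses recovered from integrals of test functions *)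

Section Determination.
Context {R : realType}.
Local Open Scope ereal_scope.

Lemma integral_bump_cvg (mu : {measure set (measurableTypeR R) -> \bar R})
    (a b : R) : mu `[a, (b + 1)%R]%classic < +oo ->
  \int[mu]_t (bump a b n.+1 t)%:E @[n --> \oo] --> mu `]a, b]%classic.
Proof.
move=> mufin.
have mE : mu `]a, b]%classic = \int[mu]_t (\1_`]a, b] t)%:E.
  by rewrite integral_indic ?setIT//; exact: measurable_itv.
rewrite mE.
have mI : measurable (`[a, (b + 1)%R]%classic : set (measurableTypeR R)).
  exact: measurable_itv.
have [] // := @dominated_convergence _ (measurableTypeR R) R mu setT
    measurableT (fun n t => (bump a b n.+1 t)%:E)
    (fun t => (\1_`]a, b] t)%:E) (fun t => (\1_`[a, (b + 1)%R] t)%:E).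
- move=> n; apply/measurable_EFinP.
  by apply: continuous_measurable_fun; exact: continuous_bump.
- by apply/measurable_EFinP; apply: measurable_indic; exact: measurable_itv.
- apply: aeW => t _; apply: cvg_EFin; first exact: nearW.
  by rewrite (cvg_shiftS (fun n => bump a b n t)); exact: bump_cvg.
- apply/integrableP; split; first by apply/measurable_EFinP; exact: measurable_indic.
  under eq_integral do rewrite gee0_abs ?lee_fin//.
  by rewrite integral_indic// setIT.
- apply: aeW => t n _; have /andP[b0 b1] := bump_itv a b n.+1 t.
  by rewrite gee0_abs ?lee_fin//; exact: bump_le_indic.
Qed.

Lemma eq_measure_itvoc
    (mu nu : {measure set (measurableTypeR R) -> \bar R}) :
    (forall a b, mu `[a, b]%classic < +oo) -> (forall a b, nu `[a, b]%classic < +oo) ->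
    (forall f, Cc f -> \int[mu]_t (f t)%:E = \int[nu]_t (f t)%:E) ->
  forall a b, mu `]a, b]%classic = nu `]a, b]%classic.
Proof.
move=> mufin nufin munu a b.
have munub n : \int[mu]_t (bump a b n.+1 t)%:E = \int[nu]_t (bump a b n.+1 t)%:E.
  exact/munu/bump_Cc.
have := integral_bump_cvg (mufin a (b + 1)%R).
under eq_fun do rewrite munub.
by move=> /cvg_unique; apply => //; exact: integral_bump_cvg.
Qed.

Lemma lebesgue_stieltjes_itvoc (alpha : cumulative R R) (a b : R) :
  (a <= b)%R ->
  lebesgue_stieltjes_measure alpha `]a, b] = (alpha b - alpha a)%:E.
Proof.
move=> ab; rewrite /lebesgue_stieltjes_measure /measure_extension/=.
rewrite measurable_mu_extE/=; last exact: is_ocitv.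
by rewrite wlength_itv_bnd.
Qed.

Lemma lebesgue_stieltjes_itvcc_fin (alpha : cumulative R R) (a b : R) :
  lebesgue_stieltjes_measure alpha `[a, b] < +oo.
Proof.
have [ab|ba] := leP a b; last by rewrite set_itv_ge ?measure0// bnd_simp -ltNge.
(* The mass is known on left-open intervals; moving the left end to [a - 1] takes in a possible atom
   at [a]. *)
apply: (@le_lt_trans _ _ (lebesgue_stieltjes_measure alpha `]a - 1, b])%R).
  apply: le_measure; rewrite ?inE; [exact: measurable_itv..|].
  by apply: subset_itvr; rewrite bnd_simp ltrBlDr ltrDl.
by rewrite lebesgue_stieltjes_itvoc ?ltry//; lra.
Qed.

End Determination.

(** The image of the compact support is bounded, and [f] is 0 elsewhere. This serves to make
    [f \o X] integrable. *)
Lemma Cc_bounded (R : realType) (f : R -> R) :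
  Cc f -> [bounded f t | t in [set: R]].
Proof.
move=> [cf sf].
have [M [Mr fM]] : bounded_set (f @` closure [set t | f t != 0]).
  apply: compact_bounded; apply: continuous_compact => //.
  exact: continuous_subspaceT.
exists (Num.max 0 M); split => [|x]; first by rewrite num_real.
rewrite gt_max => /andP[x0 Mx] t _; have [ft0|ft0] := eqVneq (f t) 0.
  by rewrite /= ft0 normr0 ltW.
by apply: (fM x Mx); exists t => //; exact: subset_closure.
Qed.

(** * The law of [X] and its distribution function *)

Section RandomVariable.
Context {d : measure_display} {Omega : measurableType d} {R : realType}.
Context {P : probability Omega R}.
Variable X : {RV P >-> R}.

(* Lebesgue-Stieltjes measures live on [measurableTypeR R], whose display is not
   the one of the target type [R] of [X], although the measurable sets agree. *)
Definition stieltjes_RV : Omega -> measurableTypeR R := X.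

Let measurable_stieltjes_RV : measurable_fun setT stieltjes_RV.
Proof. exact: measurable_funPT X. Qed.

HB.instance Definition _ :=
  @isMeasurableFun.Build _ _ _ _ stieltjes_RV measurable_stieltjes_RV.

Definition law : {measure set (measurableTypeR R) -> \bar R} :=
  distribution P stieltjes_RV.

(** Change of variables for the image measure; [f \o X] is integrable because it is bounded and [P]
    is finite. *)
Lemma expectation_law (f : R -> R) : Cc f ->
  ('E_P[f \o X] = \int[law]_t (f t)%:E)%E.
Proof.
move=> Cf; have mf : measurable_fun setT f.
  by case: Cf => cf _; exact: continuous_measurable_fun.
rewrite unlock /law /= integral_distribution//.
  exact/measurable_EFinP.
apply: (@measurable_bounded_integrable _ _ _ _ (f \o X)) => //.
- exact: le_lt_trans (probability_le1 P measurableT) (ltry 1).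
- exact: measurableT_comp.
- have [M [Mr fM]] := Cc_bounded Cf.
  by exists M; split => // x Mx t _; exact: (fM x Mx (X t)).
Qed.

Lemma represents_itvocP (alpha : cumulative R R) :
  represents X alpha <->
  forall a b, lebesgue_stieltjes_measure alpha `]a, b] = P (X @^-1` `]a, b]).
Proof.
split=> [rep|E].
- apply: (@eq_measure_itvoc _ (lebesgue_stieltjes_measure alpha) law).
  + exact: lebesgue_stieltjes_itvcc_fin.
  + move=> a b; apply: (@le_lt_trans _ _ 1%E); last exact: ltry.
    exact: probability_le1.
  + by move=> f Cf; rewrite -expectation_law// rep.
- move=> f Cf; rewrite expectation_law//; apply: eq_measure_integral => A mA _.
  (* A measure is identified with the Lebesgue-Stieltjes measure once they agree on the generating
     intervals []a, b]]. *)
  apply/esym/(@lebesgue_stieltjes_measure_unique _ _ law) => //.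
  by move=> _ [[a b] _ <-]; exact: E.
Qed.

Lemma lebesgue_stieltjes_law (alpha : cumulative R R) (B : set R) :
  represents X alpha -> measurable B ->
  lebesgue_stieltjes_measure alpha B = P (X @^-1` B).
Proof.
move=> /represents_itvocP E mB.
apply: (@lebesgue_stieltjes_measure_unique _ _ law) => //.
by move=> _ [[a b] _ <-]; exact: E.
Qed.

(** [cdf X] takes extended real values; a real-valued version is what can carry the structure
    [cumulative R R]. *)
Definition fine_cdf (x : R) : R := fine (cdf X x).

Lemma fine_cdfE x : (fine_cdf x)%:E = P (X @^-1` `]-oo, x]).
Proof. by rewrite fineK// fin_num_measure. Qed.

Let fine_cdf_nondecreasing : nondecreasing fine_cdf.
Proof. by move=> x y xy; rewrite fine_le ?fin_num_measure// cdf_nondecreasing. Qed.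

Let fine_cdf_right_continuous : right_continuous fine_cdf.
Proof.
move=> x; apply: fine_cvg.
by rewrite fineK ?fin_num_measure//; exact: cdf_right_continuous.
Qed.

HB.instance Definition _ := isCumulative.Build R _ R fine_cdf
  fine_cdf_nondecreasing fine_cdf_right_continuous.

Lemma probability_itvoc (a b : R) : a <= b ->
  P (X @^-1` `]a, b]) = (fine_cdf b - fine_cdf a)%:E.
Proof.
move=> ab; rewrite EFinB !fine_cdfE.
have -> : `]a, b]%classic = `]-oo, b] `\` `]-oo, a].
  by rewrite -[RHS]setCK setCD setCitvl setUC -[LHS]setCK setCitv.
rewrite (_ : X @^-1` _ = X @^-1` `]-oo, b] `\` X @^-1` `]-oo, a])//.
rewrite measureD ?setIidr//.
- by apply: preimage_subset; exact: subset_itvl.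
- exact: measurable_funPTI.
- exact: measurable_funPTI.
- by rewrite -ge0_fin_numE// fin_num_measure//; exact: measurable_funPTI.
Qed.

Lemma fine_cdf_represents : represents X fine_cdf.
Proof.
apply/represents_itvocP => a b; have [ab|ba] := leP a b.
  by rewrite lebesgue_stieltjes_itvoc// probability_itvoc.
by rewrite set_itv_ge ?preimage_set0 ?measure0// bnd_simp -leNgt ltW.
Qed.

(** Both functions have the same increments, so their difference is constant; the base point 0 is
    arbitrary. *)
Lemma represents_sub_fine_cdf (alpha : cumulative R R) x :
  represents X alpha -> alpha x - fine_cdf x = alpha 0 - fine_cdf 0.
Proof.
move=> /represents_itvocP E.
have H a b : a <= b -> alpha b - alpha a = fine_cdf b - fine_cdf a.
  move=> ab; apply: EFin_inj.
  by rewrite -lebesgue_stieltjes_itvoc// -probability_itvoc.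
by have [x0|/ltW x0] := leP x 0; have := H _ _ x0; lra.
Qed.

End RandomVariable.

Theorem mainTheorem2 (d : measure_display) (Omega : measurableType d)
    (R : realType) (P : probability Omega R) (X : {RV P >-> R}) :
  (exists alpha : cumulative R R, represents X alpha) /\
  (forall alpha : cumulative R R, represents X alpha ->
    [/\ lebesgue_stieltjes_measure alpha [set: R] = 1%E,
        forall B : set R, measurable B ->
          lebesgue_stieltjes_measure alpha B = P (X @^-1` B)
      & exists c : R, alpha x @[x --> -oo] --> c /\
          exists F : cumulative R R,
            [/\ forall x, F x = alpha x - c,
                forall x, (F x)%:E = P (X @^-1` `]-oo, x]),
                F x @[x --> -oo] --> (0 : R),
                F x @[x --> +oo] --> (1 : R)
              & represents X F]]).
Proof.
split; first by exists (fine_cdf X); exact: fine_cdf_represents.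
move=> alpha rep; split.
- by rewrite (lebesgue_stieltjes_law rep)// preimage_setT probability_setT.
- by move=> B mB; exact: lebesgue_stieltjes_law.
have alphaE x : alpha x = fine_cdf X x + (alpha 0 - fine_cdf X 0).
  by have := represents_sub_fine_cdf x rep; lra.
have cdfNy : fine_cdf X x @[x --> -oo] --> (0 : R).
  exact/fine_cvg/cvg_cdfNy0.
(* As the distribution function tends to 0 at [-oo], the constant difference is the limit of [alpha]
   there. *)
exists (alpha 0 - fine_cdf X 0); split.
  rewrite -[X in _ --> X]add0r; under eq_fun do rewrite alphaE.
  by apply: cvgD => //; exact: cvg_cst.
(* Taking the distribution function itself for [F], rather than building [alpha - c], reuses its
   [cumulative] structure. *)
exists (fine_cdf X); split.
- by move=> x; rewrite [alpha x]alphaE addrK.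
- exact: fine_cdfE.
- exact: cdfNy.
- exact/fine_cvg/cvg_cdfy1.
- exact: fine_cdf_represents.
Qed.
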